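(* Let $p\ge 3$ be a prime and let $a(n)=a_{1+x,p}(n)$ be the number of accessible $n$-blocks for $1+x$ modulo $p$. Fix a real number $x$ with $\frac1p\le x\le 1$ and put $n=\lfloor p^k/x\rfloor$. Then, as $k\to\infty$ (with $x$ fixed), $\frac{a(n)}{n^2}$ converges to $$\begin{cases} \displaystyle\frac{p^2(p-5)(p-1)}{2(p+1)}\Big(x+\frac{p+1}{p(p-5)}\Big)^2+\frac{(p-1)(p^2-7p+4)}{2(p-5)} & \frac1p\le x\le\frac13,\\[1em] \displaystyle-\frac{(p-1)(7p^3-8p^2-9p+18)}{4(p+1)}\Big(x-\frac{(p+1)(3p^2-7p+6)}{7p^3-8p^2-9p+18}\Big)^2+\frac{(p-1)(p^5+5p^4-8p^3-15p^2+39p-18)}{2(7p^3-8p^2-9p+18)} & \frac13\le x\le\frac12,\\[1em] \displaystyle\frac{(p-2)(p-1)(p^2+2p+5)}{4(p+1)}\Big(x-\frac{(p+1)^2}{p^2+2p+5}\Big)^2+\frac{(p-1)(p^3+4p^2+3p-4)}{2(p^2+2p+5)} & \frac12\le x\le 1, \end{cases}$$ where for $p=5$ the first expression is to be understood as its limit as $p\to5$, namely the linear polynomial $20x+8$.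
   Context: For a prime $p$ and a polynomial $f(x)$ with integer coefficients, ''row $i$'' is the string of coefficients of $f(x)^i$ reduced modulo $p$, ordered by increasing powers of $x$ (from $x^0$ up to $x^{\deg f^i}$). An $m$-block is a string of $m$ residues modulo $p$; it is accessible if it occurs as a substring of consecutive entries of row $i$ for some $i\ge0$. $a_{f,p}(m)$ is the number of accessible $m$-blocks, with the convention $a_{f,p}(0)=1$. *)

(* Defs.v *)
From HB Require Import structures.
From mathcomp Require Import all_boot all_order all_algebra.
From mathcomp Require Import all_classical all_reals all_analysis.

Set Implicit Arguments.
Unset Strict Implicit.
Unset Printing Implicit Defensive.

Import Order.TTheory GRing.Theory Num.Theory.
Import numFieldNormedType.Exports.

Local Open Scope ring_scope.

(* The length of a row is fixed by the degree of [f ^+ i] over the integers,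
   before reduction, so a leading coefficient divisible by [p] gives a zero
   entry. *)
Definition row_mod (p : nat) (f : {poly int}) (i : nat) : seq 'F_p :=
  [seq c%:~R | c <- f ^+ i].

Definition accessible (p : nat) (f : {poly int}) (m : nat)
    (b : m.-tuple 'F_p) : Prop :=
  exists i : nat, infix b (row_mod p f i).

(* For [m = 0] the only block is the empty one, which is accessible, so the
   value is 1. *)
Definition num_accessible (p : nat) (f : {poly int}) (m : nat) : nat :=
  #|[set b : m.-tuple 'F_p | `[< accessible f b >] ]|.

Section Limits.
Variables (R : realType) (q : nat) (x : R).
Let p : R := q%:R.

(* At [p = 5] the generic expression has poles, which cancel after expansion. *)
Definition limit_low : R :=
  if q == 5%N then 20 * x + 8
  else p ^+ 2 * (p - 5) * (p - 1) / (2 * (p + 1))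
         * (x + (p + 1) / (p * (p - 5))) ^+ 2
       + (p - 1) * (p ^+ 2 - 7 * p + 4) / (2 * (p - 5)).

Definition limit_mid : R :=
  - ((p - 1) * (7 * p ^+ 3 - 8 * p ^+ 2 - 9 * p + 18) / (4 * (p + 1)))
      * (x - (p + 1) * (3 * p ^+ 2 - 7 * p + 6)
             / (7 * p ^+ 3 - 8 * p ^+ 2 - 9 * p + 18)) ^+ 2
  + (p - 1) * (p ^+ 5 + 5 * p ^+ 4 - 8 * p ^+ 3 - 15 * p ^+ 2 + 39 * p - 18)
      / (2 * (7 * p ^+ 3 - 8 * p ^+ 2 - 9 * p + 18)).

Definition limit_high : R :=
  (p - 2) * (p - 1) * (p ^+ 2 + 2 * p + 5) / (4 * (p + 1))
    * (x - (p + 1) ^+ 2 / (p ^+ 2 + 2 * p + 5)) ^+ 2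
  + (p - 1) * (p ^+ 3 + 4 * p ^+ 2 + 3 * p - 4) / (2 * (p ^+ 2 + 2 * p + 5)).

End Limits.

(* Main.v *)
Require Import Defs.
From HB Require Import structures.
From mathcomp Require Import all_boot all_order all_algebra.
From mathcomp Require Import all_classical all_reals all_analysis.
From mathcomp Require Import zify ring lra.

Import Order.TTheory GRing.Theory Num.Theory.
Import numFieldNormedType.Exports.

Local Open Scope ring_scope.

(** Write [a m] for the number of accessible blocks of length [m], and let a
    window be a block [C(i, j), ..., C(i, j + m - 1)] modulo [p], which may run
    past the end of row [i]; by Lucas' theorem the rows [p ^ K + i] show that
    all windows are accessible. The windows with [i = r] and [j = s] modulo [p]
    are in bijection with the windows of length about [m / p]. They satisfy
    [(j + t + 1) w_(t+1) = (i - j - t) w_t], so for [m >= 3] a window obtained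
    from two distinct pairs [(r, s)] is, up to a scalar, one of [0...0],
    [0...01], [10...0] and [1, -1, 1, ...]. Counting these with multiplicity
    gives [a m + p^2 - 1 + 3 (p - 1)^2] as a sum of [p^2] earlier values of [a].
    For the differences [d m = a (m + 1) - a m] this reads
    [d (p q + t) = (p - t) d q + t d (q + 1)]: hence [d] is affine between
    [p^k q] and [p^k (q + 1)], and even on the whole of [3 p^k, p^(k+1)]. So [a]
    is quadratic on each of the three intervals of the statement. *)

(** * Binomial coefficients modulo [p] *)

Lemma coef_exp1DX (A : comNzRingType) (n k : nat) :
  ((1 + 'X) ^+ n : {poly A})`_k = 'C(n, k)%:R.
Proof.
elim: n k => [|n IHn] [|k]; rewrite ?expr0 ?coef1 ?bin0 ?bin0n //.
  by rewrite exprS mulrDl mul1r coefD coefXM /= IHn addr0 bin0.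
by rewrite exprS mulrDl mul1r coefD coefXM /= !IHn binS natrD.
Qed.

Lemma size_exp1DX (A : idomainType) (n : nat) :
  size ((1 + 'X) ^+ n : {poly A}) = n.+1.
Proof.
by rewrite addrC -[1]opprK -polyC1 -polyCN size_exp_XsubC.
Qed.

(** Lucas' theorem in base [q = p ^ K]: by Frobenius [(1 + X)^(q a + b) = (1 + X^q)^a (1 + X)^b],
    and coefficients are compared by induction on [a]. *)
Lemma lucas_pow (p K a b c d : nat) :
  prime p -> (b < p ^ K)%N -> (d < p ^ K)%N ->
  'C(p ^ K * a + b, p ^ K * c + d)%:R = 'C(a, c)%:R * 'C(b, d)%:R :> 'F_p.
Proof.
move=> p_pr ltb ltd; set q := (p ^ K)%N in ltb ltd *.
have q_gt0 : (0 < q)%N by rewrite expn_gt0 prime_gt0.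
have chp : p \in [pchar {poly 'F_p}].
  by rewrite pchar_poly; apply: pchar_Fp.
have frob : (1 + 'X) ^+ q = 1 + 'X^q :> {poly 'F_p}.
  rewrite exprDn_pchar ?expr1n //.
  by rewrite pnatX pnatE ?chp ?orbT.
rewrite -coef_exp1DX exprD exprM frob -/q.
elim: a c => [|a IHa] c.
  rewrite expr0 mul1r coef_exp1DX bin0n.
  case: c => [|c]; first by rewrite muln0 add0n mul1r.
  by rewrite bin_small ?mul0r // mulnS; lia.
rewrite exprS -mulrA mulrDl mul1r coefD IHa coefXnM.
case: c => [|c].
  by rewrite muln0 add0n ltd addr0 !bin0.
have -> : (q * c.+1 + d < q)%N = false by rewrite mulnS; lia.
have -> : (q * c.+1 + d - q = q * c + d)%N by rewrite mulnS; lia.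
by rewrite IHa binS natrD mulrDl.
Qed.

(** * Accessible blocks as windows of Pascal's triangle *)

Definition window (p m i j : nat) : m.-tuple 'F_p :=
  [tuple 'C(i, j + t)%:R | t < m].

(** Row [p ^ K + i] is two copies of row [i] separated by zeros, and [c] chooses the copy: [c = 0]
    keeps the window away from the end of the row, [c = 1] leaves room to its left. *)
Lemma window_period (p m i j K c : nat) :
  prime p -> (c <= 1)%N -> (i + j + m < p ^ K)%N ->
  window p m (p ^ K + i) (p ^ K * c + j) = window p m i j.
Proof.
move=> p_pr lec ltK; apply: eq_from_tnth => t; rewrite !tnth_mktuple.
have := ltn_ord t => ltt.
rewrite -addnA -[X in (X + i)%N]muln1 lucas_pow //; [|lia..].
by case: c lec => [|[]] //; rewrite ?bin0 ?binn mul1r.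
Qed.

Lemma ltn_expl_ex (p n : nat) : (1 < p)%N -> exists K, (n < p ^ K)%N.
Proof. by move=> p_gt1; exists n; apply: ltn_expl. Qed.

Lemma accessible_window (p m : nat) (b : m.-tuple 'F_p) : prime p ->
  accessible (1 + 'X) b <-> exists i j, b = window p m i j.
Proof.
move=> p_pr.
have row_nth i k : (k <= i)%N ->
    nth 0 (row_mod p (1 + 'X) i) k = 'C(i, k)%:R.
  move=> lek; rewrite /row_mod (nth_map 0) ?size_exp1DX //.
  by rewrite coef_exp1DX mulrz_nat.
have row_size i : size (row_mod p (1 + 'X) i) = i.+1.
  by rewrite size_map size_exp1DX.
split=> [[i /infixP [s1 [s2 def_row]]]|[i [j ->]]].
  exists i, (size s1); apply: eq_from_tnth => t.
  have ltt := ltn_ord t; rewrite tnth_mktuple (tnth_nth 0).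
  have := row_size i; rewrite def_row !size_cat size_tuple => eq_sz.
  rewrite -(row_nth i); last by rewrite -ltnS -eq_sz ltn_add2l ltn_addr.
  by rewrite def_row nth_cat ltnNge leq_addr /= addKn nth_cat size_tuple ltt.
have [K ltK] := ltn_expl_ex p (i + j + m) (prime_gt1 p_pr).
rewrite -(window_period p m i j K 0) // muln0 add0n.
exists (p ^ K + i)%N; apply/infixP.
exists (take j (row_mod p (1 + 'X) (p ^ K + i))).
exists (drop m (drop j (row_mod p (1 + 'X) (p ^ K + i)))).
rewrite -[LHS](cat_take_drop j); congr (_ ++ _).
rewrite -[LHS](cat_take_drop m); congr (_ ++ _).
apply: (@eq_from_nth _ 0); rewrite size_takel ?size_drop ?row_size ?size_tuple //; try lia.
move=> t ltt; rewrite nth_take // nth_drop row_nth; last by lia.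
by rewrite -[t]/(nat_of_ord (Ordinal ltt)) -tnth_nth tnth_mktuple.
Qed.

Lemma nth_window (p m i j t : nat) : (t < m)%N ->
  nth 0 (window p m i j) t = 'C(i, j + t)%:R.
Proof.
move=> ltt; have := tnth_nth 0 (window p m i j) (Ordinal ltt).
by rewrite tnth_mktuple.
Qed.

Definition windows (p m : nat) : {set m.-tuple 'F_p} :=
  [set b | `[< exists i j, b = window p m i j >]].

Lemma num_accessible_windows (p m : nat) : prime p ->
  num_accessible p (1 + 'X) m = #|windows p m|.
Proof.
move=> p_pr; apply: eq_card => b; rewrite !inE.
by apply/asboolP/asboolP => /accessible_window; apply.
Qed.

Lemma window_in (p m i j : nat) : window p m i j \in windows p m.
Proof. by rewrite inE; apply/asboolP; exists i, j. Qed.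

(** * Windows by the residues of their row and position *)

Definition cwindows (p m : nat) (r s : 'F_p) : {set m.-tuple 'F_p} :=
  [set b | `[< exists i j, [/\ i%:R = r, j%:R = s & b = window p m i j] >]].

Lemma cwindowsP (p m : nat) (r s : 'F_p) (b : m.-tuple 'F_p) :
  reflect (exists i j, [/\ i%:R = r, j%:R = s & b = window p m i j])
          (b \in cwindows p m r s).
Proof. by rewrite inE; apply: asboolP. Qed.

Lemma natr_Fp_divn (p i : nat) (r : 'F_p) : prime p ->
  i%:R = r -> i = (p * (i %/ p) + r)%N.
Proof.
by move=> p_pr <-; rewrite val_Fp_nat // mulnC -divn_eq.
Qed.

Lemma natr_Fp_val (p i : nat) (r : 'F_p) : prime p ->
  (p * i + r)%:R = r.
Proof.
move=> p_pr; rewrite natrD natrM pchar_Fp_0 // mul0r add0r.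
by rewrite natr_Zp.
Qed.

Lemma ltn_Fp (p : nat) (r : 'F_p) : prime p -> (r < p)%N.
Proof. by move=> p_pr; rewrite -[X in (_ < X)%N](Fp_cast p_pr). Qed.

Lemma bin_Fp_neq0 (p r k : nat) : prime p -> (k <= r < p)%N ->
  'C(r, k)%:R != 0 :> 'F_p.
Proof.
move=> p_pr /andP[lek ltr]; rewrite -(dvdn_pcharf (pchar_Fp p_pr)).
have : ~~ (p %| r`!)%N.
  elim: r {k lek} ltr => [|r IHr] ltr; first by rewrite dvdn1; case: p p_pr {ltr} => [|[]].
  rewrite factS Euclid_dvdM // negb_or IHr 1?ltnW // andbT.
  by apply/negP => /dvdn_leq => /(_ isT); rewrite leqNgt ltr.
by apply: contra; rewrite -(bin_fact lek) => /dvdn_mulr; apply.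
Qed.

(* By Lucas, the window of length [m] at position [p * j + s] of row [p * i + r]
   is made of the entries of row [i] from [j] on, times entries of row [r]; when
   [r < s] the entry at [j] is only multiplied by zeros, so it is not counted. *)
Definition visible (p m r s : nat) : nat :=
  ((s + m.-1) %/ p).+1 - (r < s).

(** For [r < s] the sequence [u] starts one entry later, hence the shift of the index. Where the
    truncated subtraction reads a wrong entry, the binomial factor is zero. *)
Definition spread (p m r s : nat) (u : seq 'F_p) : m.-tuple 'F_p :=
  [tuple nth 0 u ((s + t) %/ p - (r < s)%N) * 'C(r, (s + t) %% p)%:R | t < m].

Lemma spread_window (p m r s i j : nat) :
  prime p -> (r < p)%N -> (s < p)%N ->
  spread p m r s (window p (visible p m r s) i (j + (r < s)%N)) =
  window p m (p * i + r) (p * j + s).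
Proof.
move=> p_pr ltr lts; apply: eq_from_tnth => t; rewrite !tnth_mktuple.
have ltt := ltn_ord t; have p_gt0 := prime_gt0 p_pr.
have -> : (p * j + s + t = p * (j + (s + t) %/ p) + (s + t) %% p)%N.
  by rewrite mulnDr -!addnA [(p * (_ %/ _))%N]mulnC -divn_eq.
have := @lucas_pow p 1 i r (j + (s + t) %/ p) ((s + t) %% p) p_pr.
rewrite !expn1 => -> //; last by rewrite ltn_mod.
have le_div : ((s + t) %/ p <= (s + m.-1) %/ p)%N by apply: leq_div2r; lia.
have [lt_rs|le_sr] := ltnP r s; last first.
  have lt0 : ((s + t) %/ p < (visible p m r s))%N.
    by rewrite /visible [(r < s)%N]ltnNge le_sr subn0 ltnS.
  by rewrite subn0 addn0 nth_window.
case: (posnP ((s + t) %/ p)) => [div0|div_gt0].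
  have lt_st : (s + t < p)%N by rewrite ltnNge -divn_gt0 // div0.
  by rewrite modn_small // bin_small ?mulr0 //; lia.
have lt0 : ((s + t) %/ p - 1 < (visible p m r s))%N.
  by rewrite /visible lt_rs; lia.
by rewrite nth_window //; congr ('C(_, _)%:R * _); lia.
Qed.

Lemma spread_inj (p m r s : nat) : prime p -> (0 < m)%N ->
  (r < p)%N -> (s < p)%N ->
  injective (fun u : (visible p m r s).-tuple 'F_p => spread p m r s u).
Proof.
move=> p_pr m_gt0 ltr lts u v eq_uv; have p_gt0 := prime_gt0 p_pr.
apply: eq_from_tnth => g; rewrite !(tnth_nth 0).
have ltg : (g + (r < s)%N <= (s + m.-1) %/ p)%N.
  by have := ltn_ord g; rewrite {2}/visible; lia.
(* Every entry of [u] occurs with a nonzero factor: at [t = 0] if [g = 0] and [s <= r], otherwise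
   where [s + t] is a multiple of [p] and the factor is [C(r, 0) = 1]. *)
suff [t [ltt eq_g leC]] : exists t, [/\ (t < m)%N,
    ((s + t) %/ p - (r < s)%N)%N = g & ((s + t) %% p <= r)%N].
  have := congr1 (@tnth _ _ ^~ (Ordinal ltt)) eq_uv.
  rewrite !tnth_mktuple /= eq_g; apply: mulIf.
  by apply: bin_Fp_neq0; rewrite ?leC.
case: (posnP (g + (r < s)%N)) => [g0|g_gt0].
  by exists 0%N; rewrite addn0 modn_small ?divn_small //; split; lia.
have le_s : (s <= p * (g + (r < s)%N))%N.
  by apply: leq_trans (ltnW lts) _; rewrite leq_pmulr.
exists (p * (g + (r < s)%N) - s)%N; rewrite subnKC // mulKn // addnK modnMr; split=> //.
by move: ltg; rewrite leq_divRL // mulnC; lia.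
Qed.

Lemma card_cwindows (p m : nat) (r s : 'F_p) : prime p -> (0 < m)%N ->
  #|cwindows p m r s| = #|windows p (visible p m r s)|.
Proof.
move=> p_pr m_gt0; have [ltr lts] := (ltn_Fp p r p_pr, ltn_Fp p s p_pr).
rewrite -(card_imset _ (spread_inj p m r s p_pr m_gt0 ltr lts)).
apply: eq_card => b; apply/cwindowsP/imsetP => [[i [j [Ei Ej ->]]]|].
  exists (window p (visible p m r s) (i %/ p) (j %/ p + (r < s)%N)).
    exact: window_in.
  rewrite spread_window //.
  by rewrite -(natr_Fp_divn p i r p_pr Ei) -(natr_Fp_divn p j s p_pr Ej).
case=> u; rewrite inE => /asboolP[i [j ->]] ->.
(* For [r < s] the position must move one entry to the left, which fails at [j = 0]; the second copy
   of row [i] leaves that room. *)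
have [K ltK] := ltn_expl_ex p (i + j + visible p m r s) (prime_gt1 p_pr).
rewrite -(window_period p _ i j K 1) // muln1.
set i' := (p ^ K + i)%N; set j' := (p ^ K + j - (r < s)%N)%N.
exists (p * i' + r)%N, (p * j' + s)%N; rewrite !natr_Fp_val //; split=> //.
rewrite -spread_window //; congr (tval (spread _ _ _ _ _)).
by congr (tval (window _ _ _ _)); rewrite /j'; lia.
Qed.

(** * Windows arising from several residue classes *)

(** This is [(k + 1) C(i, k + 1) = (i - k) C(i, k)] at [k = j + t]; modulo [p] it involves [i] and
    [j] only through [r] and [s]. *)
Lemma cwindow_rec (p m : nat) (r s : 'F_p) (b : m.-tuple 'F_p) (t : nat) :
  b \in cwindows p m r s -> (t.+1 < m)%N ->
  (s + t.+1%:R) * nth 0 b t.+1 = (r - s - t%:R) * nth 0 b t.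
Proof.
move=> /cwindowsP[i [j [<- <- ->]]] ltt.
rewrite !nth_window ?(ltnW ltt) // -natrD addnS -natrM mul_bin_left.
(* For [i < j + t] the subtraction in [nat] truncates, but then [C(i, j + t)] vanishes. *)
have [lei|lti] := leqP (j + t) i; last first.
  by rewrite (eqP (ltnW lti : _ == 0)%N) mul0n bin_small // mulr0.
by rewrite natrM natrB // natrD; ring.
Qed.

Definition last_word (p m : nat) (c : 'F_p) : m.-tuple 'F_p :=
  [tuple if t.+1 == m :> nat then c else 0 | t < m].

Definition first_word (p m : nat) (c : 'F_p) : m.-tuple 'F_p :=
  [tuple if t == 0 :> nat then c else 0 | t < m].

Definition alt_word (p m : nat) (c : 'F_p) : m.-tuple 'F_p :=
  [tuple (-1) ^+ t * c | t < m].

Lemma nth_mktuple0 (A : nmodType) (m : nat) (f : 'I_m -> A) (t : nat)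
  (ltt : (t < m)%N) : nth 0 (mktuple f) t = f (Ordinal ltt).
Proof. by have := tnth_nth 0 (mktuple f) (Ordinal ltt); rewrite tnth_mktuple. Qed.

(** The inner entries of row [p ^ K] vanish, so by Pascal's rule neighbours in the row above are
    opposite. *)
Lemma bin_pred_pow (p K z : nat) : prime p -> (z < p ^ K)%N ->
  'C((p ^ K).-1, z)%:R = (-1) ^+ z :> 'F_p.
Proof.
move=> p_pr; elim: z => [|z IHz] ltz; first by rewrite bin0.
have := @lucas_pow p K 1 0 0 z.+1 p_pr (leq_ltn_trans (leq0n _) ltz) ltz.
rewrite muln1 addn0 muln0 add0n bin0 mul1r bin0n.
have q_gt0 : (0 < p ^ K)%N by apply: leq_ltn_trans ltz.
rewrite -{1}(prednK q_gt0) binS natrD (IHz (ltnW ltz)) => /eqP.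
by rewrite addr_eq0 => /eqP ->; rewrite exprS mulN1r.
Qed.

Lemma natr_pow_Fp (p K i : nat) : prime p -> (0 < K)%N ->
  (p ^ K * i)%:R = 0 :> 'F_p.
Proof. by case: K => // K p_pr _; rewrite expnS natrM natrM pchar_Fp_0 // !mul0r. Qed.

(** The last step of [cwindow_rec] forces [s]. Conversely, row [p ^ K * c + r] has [c] at position
    [p ^ K], with zeros just before it. *)
Lemma mem_last_word (p m : nat) (r s c : 'F_p) : prime p -> (1 < m)%N ->
  c != 0 -> (last_word p m c \in cwindows p m r s) = (s == - m.-1%:R).
Proof.
move=> p_pr m_gt1 c0; apply/idP/eqP => [b_in|Es].
  case: m m_gt1 b_in => [|[|m]] // _ b_in; have := cwindow_rec _ _ _ _ _ m b_in.
  move=> /(_ (leqnn _)); rewrite (nth_mktuple0 _ _ _ _ (leqnn _)) /= eqxx.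
  rewrite (nth_mktuple0 _ _ _ _ (ltnW (leqnn _))) /= ltn_eqF // mulr0 => /eqP.
  by rewrite mulf_eq0 (negPf c0) orbF addr_eq0 => /eqP.
have [K ltK] := ltn_expl_ex p (m + p) (prime_gt1 p_pr).
have K_gt0 : (0 < K)%N by case: K ltK => //; rewrite expn0; lia.
have ltr := ltn_Fp p r p_pr.
apply/cwindowsP; exists (p ^ K * c + r)%N, (p ^ K - m.-1)%N; split.
- by rewrite natrD natr_pow_Fp // add0r natr_Zp.
- rewrite natrB; last by lia.
  by rewrite -[(p ^ K)%N]muln1 natr_pow_Fp // Es sub0r.
apply: eq_from_tnth => t; rewrite !tnth_mktuple; have ltt := ltn_ord t.
case: eqP => [Et|Et].
  have -> : (p ^ K - m.-1 + t = p ^ K * 1 + 0)%N by lia.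
  by rewrite lucas_pow // ?bin1 ?bin0 ?mulr1 ?natr_Zp //; lia.
have -> : (p ^ K - m.-1 + t = p ^ K * 0 + (p ^ K - m.-1 + t))%N by lia.
rewrite lucas_pow //; [|lia..].
by rewrite [X in _ * X%:R]bin_small ?mulr0 //; lia.
Qed.

(** The first step of [cwindow_rec] forces [s = r]. Conversely, row [p ^ K * c + r] has [c] at
    position [p ^ K + r], then zeros. *)
Lemma mem_first_word (p m : nat) (r s c : 'F_p) : prime p -> (1 < m)%N ->
  c != 0 -> (first_word p m c \in cwindows p m r s) = (s == r).
Proof.
move=> p_pr m_gt1 c0; apply/idP/eqP => [b_in|->].
  have := cwindow_rec _ _ _ _ _ 0 b_in m_gt1.
  rewrite (nth_mktuple0 _ _ _ _ m_gt1) (nth_mktuple0 _ _ _ _ (ltnW m_gt1)) /=.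
  rewrite mulr0 subr0 => /esym/eqP; rewrite mulf_eq0 (negPf c0) orbF subr_eq0.
  by move/eqP.
have [K ltK] := ltn_expl_ex p (m + p) (prime_gt1 p_pr).
have K_gt0 : (0 < K)%N by case: K ltK => //; rewrite expn0; lia.
have ltr := ltn_Fp p r p_pr.
apply/cwindowsP; exists (p ^ K * c + r)%N, (p ^ K * 1 + r)%N; split.
- by rewrite natrD natr_pow_Fp // add0r natr_Zp.
- by rewrite natrD natr_pow_Fp // add0r natr_Zp.
apply: eq_from_tnth => t; rewrite !tnth_mktuple; have ltt := ltn_ord t.
rewrite -addnA lucas_pow //; [|lia..].
rewrite bin1 natr_Zp; case: eqP => [->|Et]; first by rewrite addn0 binn mulr1.
by rewrite bin_small ?mulr0 //; lia.
Qed.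

(** The first step of [cwindow_rec] reads [- (s + 1) c = (r - s) c]. Conversely, the alternating row
    [p ^ K - 1] is used, with [c'] absorbing the sign at position [s]. *)
Lemma mem_alt_word (p m : nat) (r s c : 'F_p) : prime p -> (1 < m)%N ->
  c != 0 -> (alt_word p m c \in cwindows p m r s) = (r == -1).
Proof.
move=> p_pr m_gt1 c0; apply/idP/eqP => [b_in|->].
  have := cwindow_rec _ _ _ _ _ 0 b_in m_gt1.
  rewrite (nth_mktuple0 _ _ _ _ m_gt1) (nth_mktuple0 _ _ _ _ (ltnW m_gt1)) /=.
  rewrite expr1 expr0 mul1r mulrA => /(mulIf c0) E.
  by have -> : r = (r - s - 0) + s; [ring | rewrite -E; ring].
have [K ltK] := ltn_expl_ex p (m + p) (prime_gt1 p_pr).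
have K_gt0 : (0 < K)%N by case: K ltK => //; rewrite expn0; lia.
have lts := ltn_Fp p s p_pr.
pose c' : 'F_p := (-1) ^+ s * c.
apply/cwindowsP; exists (p ^ K * c' + (p ^ K).-1)%N, (p ^ K * 1 + s)%N; split.
- rewrite natrD natr_pow_Fp // add0r -subn1 natrB; last by lia.
  by rewrite -[(p ^ K)%N]muln1 natr_pow_Fp // sub0r.
- by rewrite natrD natr_pow_Fp // add0r natr_Zp.
apply: eq_from_tnth => t; rewrite !tnth_mktuple; have ltt := ltn_ord t.
rewrite -addnA lucas_pow //; [|lia..].
rewrite bin1 natr_Zp bin_pred_pow //; last by lia.
by rewrite /c' mulrAC -exprD addnA addnn exprD -mul2n exprM sqrrN !expr1n mul1r.
Qed.

Lemma mem_zero_word (p m : nat) (r s : 'F_p) : prime p ->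
  last_word p m 0 \in cwindows p m r s.
Proof.
move=> p_pr; apply/cwindowsP; exists r, (p * r.+1 + s)%N.
split; [by rewrite natr_Zp | exact: natr_Fp_val |].
apply: eq_from_tnth => t; rewrite !tnth_mktuple if_same bin_small //.
by have := prime_gt0 p_pr; nia.
Qed.

(* Subtracting the relations [cwindow_rec] for the two classes makes the window
   geometric; a ratio other than [0] and infinity must be [-1]. *)
Lemma cwindows_overlap (p m : nat) (r s r' s' : 'F_p) (b : m.-tuple 'F_p) :
  prime p -> (2 < m)%N ->
  b \in cwindows p m r s -> b \in cwindows p m r' s' -> (r, s) != (r', s') ->
  exists c, [\/ b = last_word p m c, b = first_word p m c
             | b = alt_word p m c].
Proof.
move=> p_pr m_gt2 b_in b_in' neq_rs.
have rec t := cwindow_rec _ _ _ _ _ t b_in.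
have rec' t := cwindow_rec _ _ _ _ _ t b_in'.
have diff t : (t.+1 < m)%N ->
    (s - s') * nth 0 b t.+1 = (r - r' - (s - s')) * nth 0 b t.
  move=> ltt; apply/eqP; rewrite -subr_eq0; apply/eqP.
  have -> : (s - s') * nth 0 b t.+1 - (r - r' - (s - s')) * nth 0 b t =
     ((s + t.+1%:R) * nth 0 b t.+1 - (r - s - t%:R) * nth 0 b t) -
     ((s' + t.+1%:R) * nth 0 b t.+1 - (r' - s' - t%:R) * nth 0 b t) by ring.
  by rewrite rec // rec' // !subrr.
(* If [s = s'], the left side of [diff] is zero and [r != r'], so all entries but the last
   vanish. *)
have [eq_s|neq_s] := eqVneq s s'.
  exists (nth 0 b m.-1); constructor 1; apply: eq_from_tnth => t.
  rewrite tnth_mktuple (tnth_nth 0); case: eqP => [Et|neq_t].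
    by congr (nth _ _ _); lia.
  have ltt : (t.+1 < m)%N by have := ltn_ord t; lia.
  have /eqP := diff t ltt; rewrite eq_s subrr mul0r subr0 eq_sym mulf_eq0.
  case/orP => [|/eqP //]; rewrite subr_eq0 => /eqP eq_r.
  by rewrite eq_r eq_s eqxx in neq_rs.
pose lam := (r - r' - (s - s')) / (s - s').
have ds0 : s - s' != 0 by rewrite subr_eq0.
have geom t : (t.+1 < m)%N -> nth 0 b t.+1 = lam * nth 0 b t.
  by move=> /diff E; apply: (mulfI ds0); rewrite E /lam; field.
have geomX t : (t < m)%N -> nth 0 b t = lam ^+ t * nth 0 b 0.
  elim: t => [|t IHt] ltt; first by rewrite mul1r.
  by rewrite geom // IHt 1?ltnW // exprS mulrA.
exists (nth 0 b 0); have [b00|b00] := eqVneq (nth 0 b 0) 0.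
  constructor 1; apply: eq_from_tnth => t; rewrite tnth_mktuple (tnth_nth 0).
  by rewrite (geomX _ (ltn_ord t)) b00 mulr0 if_same.
have [lam0|lam0] := eqVneq lam 0.
  constructor 2; apply: eq_from_tnth => t; rewrite tnth_mktuple (tnth_nth 0).
  by rewrite (geomX _ (ltn_ord t)) lam0 expr0n; case: eqP => _; rewrite ?mul1r ?mul0r.
constructor 3; apply: eq_from_tnth => t; rewrite tnth_mktuple (tnth_nth 0).
rewrite (geomX _ (ltn_ord t)); congr (_ ^+ _ * _).
have := rec 0 (ltnW m_gt2); have := rec 1 m_gt2.
rewrite (geom 1) ?(geom 0) // ?(ltnW m_gt2) //.
have b10 : lam * nth 0 b 0 != 0 by rewrite mulf_neq0.
rewrite mulrA => /(mulIf b10) E1; rewrite mulrA => /(mulIf b00) E0.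
(* The relations at [t = 0] and [t = 1] are [(s + 1) lam = r - s] and [(s + 2) lam = r - s - 1];
   their difference is [lam = -1]. *)
have : (s + 2%:R) * lam - (s + 1%:R) * lam = r - s - 1%:R - (r - s - 0%:R).
  by rewrite E1 E0.
by rewrite -mulrBl => E; rewrite -[lam]mul1r; move: E; congr (_ = _); ring.
Qed.

(** * Counting windows with multiplicity *)

(** The zero word is kept among the last words only, which makes the three families disjoint. *)
Definition degenerate (p m : nat) : {set m.-tuple 'F_p} :=
  (last_word p m @: [set: 'F_p]) :|: (first_word p m @: [set~ 0]) :|:
  (alt_word p m @: [set~ 0]).

(** Entry [0] separates the last words from the others, entry [1] the other two families. The weight
    [h] serves both for a cardinality and for a sum of multiplicities. *)
Lemma sum_degenerate (p m : nat) (h : m.-tuple 'F_p -> nat) : (2 < m)%N ->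
  (\sum_(b in degenerate p m) h b =
   \sum_c h (last_word p m c) +
   \sum_(c : 'F_p | c != 0%R) (h (first_word p m c) + h (alt_word p m c)))%N.
Proof.
move=> m_gt2; have [m_gt0 m_gt1] : (0 < m)%N /\ (1 < m)%N by lia.
have first0 (c : 'F_p) : nth 0 (first_word p m c) 0 = c.
  by rewrite (nth_mktuple0 _ _ _ _ m_gt0).
have first1 (c : 'F_p) : nth 0 (first_word p m c) 1 = 0.
  by rewrite (nth_mktuple0 _ _ _ _ m_gt1).
have alt0 (c : 'F_p) : nth 0 (alt_word p m c) 0 = c.
  by rewrite (nth_mktuple0 _ _ _ _ m_gt0) /= mul1r.
have alt1 (c : 'F_p) : nth 0 (alt_word p m c) 1 = - c.
  by rewrite (nth_mktuple0 _ _ _ _ m_gt1) /= mulN1r.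
have last0 (c : 'F_p) : nth 0 (last_word p m c) 0 = 0.
  by rewrite (nth_mktuple0 _ _ _ _ m_gt0) /= ltn_eqF.
have lastm (c : 'F_p) : nth 0 (last_word p m c) m.-1 = c.
  have lt1 : (m.-1 < m)%N by lia.
  by rewrite (nth_mktuple0 _ _ _ _ lt1) /= prednK // eqxx.
have disj1 : [disjoint last_word p m @: [set: 'F_p]
                     & first_word p m @: [set~ 0]].
  rewrite disjoint_subset; apply/fintype.subsetP => _ /imsetP[c _ ->].
  rewrite inE; apply/negP => /imsetP[c']; rewrite !inE => c'0 E.
  by move: c'0; rewrite -[c']first0 -E last0 eqxx.
have disj2 : [disjoint (last_word p m @: [set: 'F_p]) :|:
                       (first_word p m @: [set~ 0]) & alt_word p m @: [set~ 0]].
  rewrite disjoint_sym disjoint_subset; apply/fintype.subsetP => _ /imsetP[c c0 ->].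
  move: c0; rewrite !inE => c0; rewrite negb_or.
  apply/andP; split; apply/negP => /imsetP[c' _ E].
    by move: c0; rewrite -[c]alt0 E last0 eqxx.
  by move: c0; rewrite -[c]opprK -[- c]alt1 E first1 oppr0 eqxx.
have sumU (A B : {set m.-tuple 'F_p}) : [disjoint A & B] ->
    (\sum_(b in A :|: B) h b = \sum_(b in A) h b + \sum_(b in B) h b)%N.
  by move=> disjAB; rewrite -bigU //=; apply: eq_bigl => b; rewrite !inE.
rewrite !sumU //.
rewrite !big_imset /=; first last.
- by move=> c c' _ _ E; rewrite -[c]lastm E lastm.
- by move=> c c' _ _ E; rewrite -[c]first0 E first0.
- by move=> c c' _ _ E; rewrite -[c]alt0 E alt0.
rewrite big_split /= addnA; congr (_ + _ + _)%N; apply: eq_bigl => c;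
  by rewrite !inE.
Qed.

Definition multiplicity (p m : nat) (b : m.-tuple 'F_p) : nat :=
  (\sum_r \sum_s (b \in cwindows p m r s))%N.

Lemma multiplicity_eq1 (p m : nat) (b : m.-tuple 'F_p) :
  prime p -> (2 < m)%N -> b \in windows p m -> b \notin degenerate p m ->
  multiplicity p m b = 1%N.
Proof.
move=> p_pr m_gt2; rewrite inE => /asboolP[i [j def_b]] good.
have b_in : b \in cwindows p m i%:R j%:R by apply/cwindowsP; exists i, j.
have zero_in : last_word p m 0 \in degenerate p m.
  by rewrite !inE imset_f ?inE.
have uniq_rs (r s : 'F_p) : (r, s) != (i%:R, j%:R) -> b \notin cwindows p m r s.
  move=> neq; apply: contra good => b_in'.
  have [c Ec] := cwindows_overlap _ _ _ _ _ _ _ p_pr m_gt2 b_in' b_in neq.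
  have [c0|c0] := eqVneq c 0; last first.
    by rewrite !inE; case: Ec => ->; rewrite ?imset_f ?orbT ?inE.
  suff -> : b = last_word p m 0 by [].
  move: Ec; rewrite c0; case=> ->; apply: eq_from_tnth => t;
    by rewrite !tnth_mktuple ?mulr0 ?if_same.
rewrite /multiplicity (bigD1 i%:R) //= (bigD1 j%:R) //= b_in.
rewrite !big1 // => [r neq_r|s neq_s]; last first.
  by rewrite (negPf (uniq_rs _ _ _)) // xpair_eqE (negPf neq_s) andbF.
rewrite big1 // => s _.
by rewrite (negPf (uniq_rs _ _ _)) // xpair_eqE (negPf neq_r).
Qed.

Lemma sum_eq_Fp (p : nat) (k : 'F_p) : (\sum_s (s == k) = 1)%N.
Proof. by rewrite (bigD1 k) //= eqxx big1 // => s /negPf ->. Qed.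

(** Double counting of pairs of a class and a window in it. The zero word lies in all [p ^ 2]
    classes, each of the [3 * p.-1] other degenerate words in [p], every other window in one. *)
Lemma sum_windows_visible (p m : nat) : prime p -> (2 < m)%N ->
  (\sum_(r : 'F_p) \sum_(s : 'F_p) #|windows p (visible p m r s)| =
   #|windows p m| + (p ^ 2).-1 + 3 * p.-1 ^ 2)%N.
Proof.
move=> p_pr m_gt2; have [m_gt0 m_gt1] : (0 < m)%N /\ (1 < m)%N by lia.
have p_gt0 := prime_gt0 p_pr.
have -> : (\sum_(r : 'F_p) \sum_(s : 'F_p) #|windows p (visible p m r s)| =
           \sum_b multiplicity p m b)%N.
  rewrite /multiplicity [RHS]exchange_big; apply: eq_bigr => r _ /=.
  rewrite [RHS]exchange_big; apply: eq_bigr => s _ /=.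
  by rewrite -card_cwindows // -sum1_card big_mkcond.
have mult_zero : multiplicity p m (last_word p m 0) = (p ^ 2)%N.
  rewrite /multiplicity (eq_bigr (fun=> p)) => [|r _].
    by rewrite sum_nat_const card_Fp // mulnn.
  rewrite (eq_bigr (fun=> 1%N)) => [|s _]; last by rewrite mem_zero_word.
  by rewrite sum_nat_const card_Fp // muln1.
have mult_last (c : 'F_p) : c != 0 -> multiplicity p m (last_word p m c) = p.
  move=> c0; rewrite /multiplicity (eq_bigr (fun=> 1%N)) => [|r _].
    by rewrite sum_nat_const card_Fp // muln1.
  by under eq_bigr do rewrite mem_last_word //; rewrite sum_eq_Fp.
have mult_first (c : 'F_p) : c != 0 -> multiplicity p m (first_word p m c) = p.
  move=> c0; rewrite /multiplicity (eq_bigr (fun=> 1%N)) => [|r _].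
    by rewrite sum_nat_const card_Fp // muln1.
  by under eq_bigr do rewrite mem_first_word //; rewrite sum_eq_Fp.
have mult_alt (c : 'F_p) : c != 0 -> multiplicity p m (alt_word p m c) = p.
  move=> c0; rewrite /multiplicity exchange_big (eq_bigr (fun=> 1%N)) => [|r _].
    by rewrite sum_nat_const card_Fp // muln1.
  by under eq_bigr do rewrite mem_alt_word //; rewrite sum_eq_Fp.
have sub_mult b : (0 < multiplicity p m b)%N -> b \in windows p m.
  rewrite lt0n sum_nat_eq0 negb_forall => /existsP[r]; rewrite /= sum_nat_eq0.
  rewrite negb_forall => /existsP[s] /=; rewrite eqb0 negbK.
  by case/cwindowsP => i [j [_ _ ->]]; apply: window_in.
have card0 : (\sum_(c : 'F_p | c != 0%R) 1 = p.-1)%N.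
  by rewrite sum1_card cardC1 card_Fp.
have degen_sub : degenerate p m \subset windows p m.
  apply/fintype.subsetP => b Db; apply: sub_mult; move: Db.
  rewrite !inE => /orP[/orP[]|] /imsetP[c].
  - move=> _ ->; have [->|c0] := eqVneq c 0; first by rewrite mult_zero expn_gt0 p_gt0.
    by rewrite mult_last.
  - by rewrite !inE => c0 ->; rewrite mult_first.
  - by rewrite !inE => c0 ->; rewrite mult_alt.
rewrite (bigID (mem (degenerate p m))) /= sum_degenerate //.
rewrite (bigD1 0) //= mult_zero.
rewrite (eq_bigr (fun=> p)) => [|c c0]; last by rewrite mult_last.
rewrite [X in (_ + X + _)%N](eq_bigr (fun=> p + p)%N) => [|c c0]; last first.
  by rewrite mult_first ?mult_alt.
have -> : (\sum_(b | b \notin degenerate p m) multiplicity p m b =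
           #|windows p m| - #|degenerate p m|)%N.
  rewrite -cardsDS // -sum1_card.
  rewrite [RHS](eq_bigl (fun b => (b \notin degenerate p m) &&
                                  (b \in windows p m))) => [|b]; last first.
    by rewrite inE.
  rewrite [RHS]big_mkcondr; apply: eq_bigr => b good.
  case: ifPn => [b_in|b_out]; first by rewrite multiplicity_eq1.
  by apply/eqP; rewrite -leqn0 leqNgt; apply: contra b_out => /sub_mult.
have le_D := subset_leq_card degen_sub.
have card_D : #|degenerate p m| = (p + 2 * p.-1)%N.
  rewrite -sum1_card sum_degenerate // sum_nat_const card_Fp // muln1.
  by rewrite big_split /= card0; lia.
have card_const k : (\sum_(c : 'F_p | c != 0%R) k = p.-1 * k)%N.
  by rewrite sum_nat_const cardC1 card_Fp.
rewrite !card_const card_D; rewrite card_D in le_D.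
move: #|windows p m| le_D p_gt0 => w; clear; case: p => // q lew _.
by rewrite !expnS expn0; lia.
Qed.

(** * Recurrences *)

Lemma card_windows_le2 (p m : nat) : prime p -> (m <= 2)%N ->
  #|windows p m| = (p ^ m)%N.
Proof.
move=> p_pr le_m; suff -> : windows p m = [set: m.-tuple 'F_p].
  by rewrite cardsT card_tuple card_Fp.
apply/setP => b; rewrite !inE; apply/asboolP.
have p_gt1 := prime_gt1 p_pr.
case: m le_m b => [|[|[|//]]] _ b.
- by exists 0%N, 0%N; apply: eq_from_tnth => -[].
- exists (tnth b ord0), 1%N; apply: eq_from_tnth => t.
  by rewrite tnth_mktuple ord1 addn0 bin1 natr_Zp.
set x := tnth b ord0; set y := tnth b ord_max.
have b_eq c : tnth c ord0 = x -> tnth c ord_max = y -> b = c.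
  move=> cx cy; apply: eq_from_tnth => t.
  have [->|] := eqVneq t ord0; first by rewrite cx.
  move=> t0; suff -> : t = ord_max by rewrite cy.
  by apply: val_inj; case: t t0 => -[|[]].
(* For [x != 0] and [z = y / x], row [p * x + z] reads [x, x * z] from position [p] on. For [x = 0]
   and [y != 0] a last word serves. *)
have [x0|x0] := eqVneq x 0; last first.
  have xz : x * (y / x) = y by rewrite mulrC divfK.
  move: (y / x) xz => z xz; have ltz := ltn_Fp p z p_pr.
  exists (p * x + z)%N, (p * 1 + 0)%N.
  have lucas d : (d < p)%N ->
      'C(p * x + z, p * 1 + d)%:R = x * 'C(z, d)%:R :> 'F_p.
    move=> ltd; have := @lucas_pow p 1 x z 1 d; rewrite expn1 => -> //.
    by rewrite bin1 natr_Zp.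
  apply: b_eq; rewrite tnth_mktuple -addnA lucas ?add0n ?prime_gt0 //.
    by rewrite bin0 mulr1.
  by rewrite bin1 natr_Zp.
have [y0|y0] := eqVneq y 0.
  exists 0%N, 1%N; apply: b_eq; rewrite tnth_mktuple bin_small ?x0 ?y0 //.
have : last_word p 2 y \in cwindows p 2 0 (-1).
  by rewrite mem_last_word.
case/cwindowsP => i [j [_ _ E]]; exists i, j; rewrite -E.
by apply: b_eq; rewrite tnth_mktuple ?x0.
Qed.

Lemma sum_Fp (p : nat) (h : nat -> nat) : prime p ->
  (\sum_(r : 'F_p) h r = \sum_(0 <= r < p) h r)%N.
Proof. by move=> p_pr; rewrite -(big_mkord xpredT h) Fp_cast. Qed.

Definition blocks (R : pzSemiRingType) (p m : nat) : R := #|windows p m|%:R.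

(** The surplus in [sum_windows_visible]. *)
Definition defect (R : pzRingType) (p : nat) : R :=
  p%:R ^+ 2 - 1 + 3 * (p%:R - 1) ^+ 2.

(** For fixed [s], the visible length is [(s + n) %/ p] for the [s] residues [r < s], and one more
    for the [p - s] others. *)
Lemma blocks_rec (R : comPzRingType) (p n : nat) : prime p -> (1 < n)%N ->
  blocks R p n.+1 + defect R p =
  \sum_(s < p) (s%:R * blocks R p ((s + n) %/ p) +
                (p%:R - s%:R) * blocks R p ((s + n) %/ p).+1).
Proof.
move=> p_pr n_gt1; have p_gt0 := prime_gt0 p_pr.
have -> : blocks R p n.+1 + defect R p =
    (\sum_(r : 'F_p) \sum_(s : 'F_p) #|windows p (visible p n.+1 r s)|)%:R.
  rewrite sum_windows_visible // /blocks /defect -addnA natrD; congr (_ + _).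
  rewrite -!subn1 natrD natrB ?expn_gt0 ?p_gt0 // natrX natrM natrX natrB //.
pose g s r := #|windows p (visible p n.+1 r s)|.
rewrite exchange_big (eq_bigr (fun s : 'F_p => \sum_(0 <= r < p) g s r)%N).
  rewrite (sum_Fp p (fun s => \sum_(0 <= r < p) g s r)%N) // big_mkord natr_sum.
  apply: eq_bigr => s _; have lts := ltn_ord s.
  rewrite (@big_cat_nat _ _ _ s) ?(ltnW lts) //= natrD; congr (_ + _).
    rewrite (eq_big_nat _ _ (F2 := fun=> #|windows p ((s + n) %/ p)|)).
      by rewrite sum_nat_const_nat subn0 natrM.
    by move=> r /andP[_ ltr]; rewrite /g /visible ltr subn1.
  rewrite (eq_big_nat _ _ (F2 := fun=> #|windows p ((s + n) %/ p).+1|)).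
    by rewrite sum_nat_const_nat natrM natrB // ltnW.
  by move=> r /andP[ler _]; rewrite /g /visible ltnNge ler subn0.
by move=> s _; rewrite -(sum_Fp p (g s)).
Qed.

Definition dblocks (R : pzRingType) (p m : nat) : R :=
  blocks R p m.+1 - blocks R p m.

(** From length [m] to [m + 1] only the summand of [blocks_rec] with [p %| s + m] changes, that is
    [s = p - t], or [s = 0] if [t = 0]; its two terms carry the weights [s] and [p - s]. *)
Lemma dblocks_rec (R : comPzRingType) (p q t : nat) :
  prime p -> (t < p)%N -> (2 < p * q + t)%N ->
  dblocks R p (p * q + t) =
  (p%:R - t%:R) * dblocks R p q + t%:R * dblocks R p q.+1.
Proof.
move=> p_pr ltt; set m := (p * q + t)%N => m_gt2; have p_gt0 := prime_gt0 p_pr.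
have := blocks_rec R p m p_pr (ltnW m_gt2).
have := blocks_rec R p m.-1 p_pr; rewrite prednK; last by lia.
move=> /(_ _) rec1 rec2; have {}rec1 := rec1 ltac:(lia).
have -> : dblocks R p m =
    (blocks R p m.+1 + defect R p) - (blocks R p m + defect R p).
  by rewrite /dblocks opprD addrACA subrr addr0.
rewrite rec1 rec2 -sumrB {rec1 rec2}.
have lt_s0 : ((p - t) %% p < p)%N by rewrite ltn_mod.
have div_pred s : ((s + m) %/ p = (p %| s + m) + (s + m.-1) %/ p)%N.
  have -> : (s + m = (s + m.-1).+1)%N by lia.
  exact: divnS.
rewrite (bigD1 (Ordinal lt_s0)) //= [X in _ + X]big1 ?addr0 => [|s]; last first.
  rewrite -val_eqE /= => neq_s; rewrite div_pred.
  suff /negPf -> : ~~ (p %| s + m)%N by rewrite subrr.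
  apply: contra neq_s; rewrite /m addnCA dvdn_addr ?dvdn_mulr // => dvd_st.
  have lts := ltn_ord s; case/dvdnP: dvd_st => k Ek.
  have [t0|t_gt0] := posnP t.
    by rewrite t0 subn0 modnn; case: k Ek => [|k]; rewrite ?mulSn; lia.
  have : k = 1%N by case: k Ek => [|[|k]]; rewrite ?mulSn; lia.
  by move=> k1; rewrite k1 in Ek; rewrite modn_small; lia.
have [t0|t_gt0] := posnP t.
  rewrite t0 subn0 modnn add0n mul0r mul0r !add0r subr0.
  rewrite /m t0 addn0 mulKn //=.
  have -> : ((p * q).-1 %/ p).+1 = q.
    by have := div_pred 0%N; rewrite !add0n /m t0 addn0 mulKn // dvdn_mulr //; lia.
  by rewrite -mulrBr mul0r addr0.
rewrite modn_small; last by lia.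
have dvd_s0 : (p - t + m = p * q.+1)%N by rewrite /m mulnS; lia.
have := div_pred (p - t)%N; rewrite dvd_s0 mulKn // dvdn_mulr // add1n => -[<-].
rewrite natrB ?(ltnW ltt) //= /dblocks.
by move: (blocks R p) p%:R t%:R => a x y; rewrite !mulrBr !mulrBl; ring.
Qed.

(** At length [p * q] the quotient in [blocks_rec] is [q] for [s > 0], and [q - 1] with weight [0]
    for [s = 0]. The weights [p - s] with [s > 0] add up to [p (p - 1) / 2]. *)
Lemma blocks_mul (R : numFieldType) (p q : nat) : prime p -> (2 < p * q)%N ->
  blocks R p (p * q) = p%:R ^+ 2 * blocks R p q +
    p%:R * (p%:R - 1) / 2 * dblocks R p q - defect R p.
Proof.
move=> p_pr pq_gt2; have p_gt0 := prime_gt0 p_pr.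
have := blocks_rec R p (p * q).-1 p_pr; rewrite prednK; last by lia.
move=> /(_ _) rec; have {}rec := rec ltac:(lia).
apply: (addIr (defect R p)); rewrite {}rec subrK.
have q_gt0 : (0 < q)%N by lia.
have div_s s : (s.+1 < p)%N -> ((s.+1 + (p * q).-1) %/ p = q)%N.
  move=> lts; have -> : (s.+1 + (p * q).-1 = q * p + s)%N by lia.
  by rewrite divnMDl // divn_small ?addn0 // ltnW.
have div_0 : ((0 + (p * q).-1) %/ p).+1 = q.
  rewrite add0n; have := divnS (p * q).-1 p_gt0.
  by rewrite prednK ?muln_gt0 ?p_gt0 // mulKn // dvdn_mulr // add1n.
case: p p_pr p_gt0 div_s div_0 {pq_gt2} => // n p_pr _ div_s div_0.
rewrite big_ord_recl mul0r add0r subr0 div_0.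
under eq_bigr => s _ do rewrite lift0 div_s ?ltnS ?ltn_ord //.
have sum_nat k (x y z : R) : \sum_(s < k) (s.+1%:R * x + (z - s.+1%:R) * y) =
    k%:R * (k%:R + 1) / 2 * x + (k%:R * z - k%:R * (k%:R + 1) / 2) * y.
  elim: k => [|k IHk]; first by rewrite big_ord0; field.
  by rewrite big_ord_recr /= IHk -natr1; field.
by rewrite sum_nat /dblocks -natr1; field.
Qed.

Lemma dblocks0 (R : pzRingType) (p : nat) : prime p -> dblocks R p 0 = p%:R - 1.
Proof. by move=> p_pr; rewrite /dblocks /blocks !card_windows_le2. Qed.

Lemma dblocks1 (R : pzRingType) (p : nat) : prime p ->
  dblocks R p 1 = p%:R ^+ 2 - p%:R.
Proof. by move=> p_pr; rewrite /dblocks /blocks !card_windows_le2 // natrX. Qed.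

Lemma dblocks_pow (R : comPzRingType) (p k q t : nat) :
  prime p -> (2 < p)%N -> (0 < q)%N -> (t <= p ^ k)%N ->
  dblocks R p (p ^ k * q + t) =
  (p%:R ^+ k - t%:R) * dblocks R p q + t%:R * dblocks R p q.+1.
Proof.
move=> p_pr p_gt2 q_gt0; elim: k t => [|k IHk] t let_.
  case: t let_ => [|[|t]] // _; first by rewrite mul1n addn0; ring.
  by rewrite mul1n addn1; ring.
have p_gt0 := prime_gt0 p_pr; have pk_gt0 : (0 < p ^ k)%N by rewrite expn_gt0 p_gt0.
have E : (p ^ k.+1 * q + t = p * (p ^ k * q + t %/ p) + t %% p)%N.
  by rewrite expnS -mulnA mulnDr -addnA [(p * (t %/ p))%N]mulnC -divn_eq.
have le_tp : (t %/ p <= p ^ k)%N.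
  by rewrite -(leq_pmul2r p_gt0) -expnSr; apply: leq_trans let_; apply: leq_divM.
have lt_mod : (t %% p < p)%N by rewrite ltn_mod.
rewrite E dblocks_rec //; last by nia.
rewrite (IHk _ le_tp) -addnS exprS.
have Et : t%:R = (t %/ p)%:R * p%:R + (t %% p)%:R :> R.
  by rewrite -natrM -natrD -divn_eq.
(* If [t %/ p = p ^ k], the induction hypothesis does not reach [t %/ p + 1], but the last digit of
   [t] is then zero, and with it the weight of that term. *)
move: le_tp; rewrite leq_eqVlt => /orP[/eqP t_eq|lt_tp].
  have mod0 : (t %% p = 0)%N.
    by move: let_; rewrite {1}(divn_eq t p) t_eq -expnSr; lia.
  by rewrite Et mod0; ring.
by rewrite (IHk _ lt_tp) Et -[(_ %/ _).+1%:R]natr1; ring.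
Qed.

(** * Explicit values at small lengths and at powers of [p] *)

(** For [n < p] this interpolates between [d 0] and [d 1], and [n = p] fits the same line. A single
    line for all these [n] is what later merges the intervals beyond [3 p^k] into one piece. *)
Lemma dblocks_small (R : comPzRingType) (p n : nat) :
  prime p -> (2 < p)%N -> (2 < n <= p)%N ->
  dblocks R p n = (p%:R - 1) * (p%:R + n%:R * (p%:R - 1)).
Proof.
move=> p_pr p_gt2 /andP[n_gt2]; rewrite leq_eqVlt => /orP[/eqP ->|ltn].
  have := dblocks_rec R p 1 0 p_pr (ltnW (ltnW p_gt2)).
  rewrite muln1 addn0 => -> //; rewrite dblocks1 //; ring.
have := dblocks_rec R p 0 n p_pr ltn; rewrite muln0 add0n => -> //.
by rewrite dblocks0 // dblocks1 //; ring.
Qed.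

Lemma blocks_sum (R : numFieldType) (p m T : nat) (u v : R) :
  (forall t, (t < T)%N -> dblocks R p (m + t) = u + t%:R * v) ->
  blocks R p (m + T) =
  blocks R p m + T%:R * u + T%:R * (T%:R - 1) / 2 * v.
Proof.
elim: T => [|T IHT] lin; first by rewrite addn0; field.
have -> : blocks R p (m + T.+1) = dblocks R p (m + T) + blocks R p (m + T).
  by rewrite /dblocks addnS subrK.
rewrite lin // IHT => [|t ltt]; last by rewrite lin // ltnW.
by rewrite -natr1; field.
Qed.

(** Since [dblocks_rec] starts at length 3, [a 3] is found from [a p], known by [blocks_mul] with
    [q = 1], by subtracting [d 3, ..., d (p - 1)]. *)
Lemma dblocks2 (R : numFieldType) (p : nat) : prime p -> (2 < p)%N ->
  dblocks R p 2 = p%:R ^+ 3 + p%:R * (p%:R - 1) / 2 * (p%:R ^+ 2 - p%:R)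
    - defect R p - p%:R ^+ 2
    - (p%:R - 3) * (p%:R - 1) * (p%:R + 3 * (p%:R - 1))
    - (p%:R - 3) * (p%:R - 4) / 2 * (p%:R - 1) ^+ 2.
Proof.
move=> p_pr p_gt2.
have := blocks_mul R p 1 p_pr; rewrite muln1 => /(_ p_gt2).
rewrite dblocks1 // {2}/blocks card_windows_le2 // => a_p.
have lin t : (t < p - 3)%N -> dblocks R p (3 + t) =
    (p%:R - 1) * (p%:R + 3 * (p%:R - 1)) + t%:R * (p%:R - 1) ^+ 2.
  move=> ltt; rewrite dblocks_small //; last by lia.
  by rewrite natrD; ring.
have := blocks_sum R p 3 (p - 3) _ _ lin; rewrite subnKC // natrB // a_p expn1.
move=> E; rewrite /dblocks.
have -> : blocks R p 2 = p%:R ^+ 2 by rewrite /blocks card_windows_le2 // natrX.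
have -> : blocks R p 3 = p%:R ^+ 2 * p%:R + p%:R * (p%:R - 1) / 2 *
    (p%:R ^+ 2 - p%:R) - defect R p -
    (p%:R - 3) * ((p%:R - 1) * (p%:R + 3 * (p%:R - 1))) -
    (p%:R - 3) * (p%:R - 3 - 1) / 2 * (p%:R - 1) ^+ 2.
  by rewrite E; ring.
by field.
Qed.

Definition lead_coef_pow (R : numFieldType) (p : nat) : R :=
  p%:R + p%:R * (p%:R - 1) / 2 - defect R p / (p%:R ^+ 2 - 1).

(** As [d (p^k) = p^k d 1], [blocks_mul] is a linear recurrence in [k]. The last two terms are a
    particular solution, and [a 1 = p] fixes the coefficient of the homogeneous solution
    [p^(2k)]. *)
Lemma blocks_pow (R : numFieldType) (p k : nat) : prime p -> (2 < p)%N ->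
  blocks R p (p ^ k) = lead_coef_pow R p * (p%:R ^+ k) ^+ 2
    - p%:R * (p%:R - 1) / 2 * p%:R ^+ k + defect R p / (p%:R ^+ 2 - 1).
Proof.
move=> p_pr p_gt2.
have p2_neq1 : p%:R ^+ 2 - 1 != 0 :> R.
  by rewrite subr_eq0 -natrX -[1]/(1%:R) eqr_nat; have := p_gt2; nia.
elim: k => [|k IHk].
  by rewrite /blocks card_windows_le2 // /lead_coef_pow; field.
have pk_gt0 : (0 < p ^ k)%N by rewrite expn_gt0 prime_gt0.
rewrite expnS blocks_mul //; last by nia.
have := dblocks_pow R p k 1 0 p_pr p_gt2 isT (leq0n _).
rewrite muln1 addn0 => ->; rewrite IHk dblocks1 // [_ ^+ k.+1]exprS /lead_coef_pow.
move: (defect R p) => C.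
by field.
Qed.

(** * Limits *)

Local Open Scope classical_set_scope.

Lemma blocks_piece (R : numFieldType) (p k j n : nat) (y d v : R) :
  (p ^ k * j <= n)%N -> blocks R p (p ^ k * j) = y ->
  (forall t, (p ^ k * j + t < n)%N ->
     dblocks R p (p ^ k * j + t) = p%:R ^+ k * d + t%:R * v) ->
  blocks R p n = y + (n%:R - j%:R * p%:R ^+ k) * (p%:R ^+ k * d)
    + (n%:R - j%:R * p%:R ^+ k) * (n%:R - j%:R * p%:R ^+ k - 1) / 2 * v.
Proof.
move=> le_n Ey lin; have En := subnKC le_n.
have := blocks_sum R p (p ^ k * j) (n - p ^ k * j) (p%:R ^+ k * d) v.
rewrite En Ey natrB // natrM natrX [p%:R ^+ k * j%:R]mulrC => -> // t ltt.
by apply: lin; lia.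
Qed.

(** Divided by [n^2], the formula is a polynomial in [w = p^k / n] and [z = 1 / n], which tend to
    [x] and [0]. *)
Lemma cvg_quadratic (R : realType) (p : nat) (x a b c d v j : R) (f : nat -> R) :
  (1 < p)%N -> 0 < x <= 1 ->
  let n := fun k : nat => Num.truncn (p%:R ^+ k / x) in
  (forall k, f (n k) = a * (p%:R ^+ k) ^+ 2 + b * p%:R ^+ k + c
    + ((n k)%:R - j * p%:R ^+ k) * (p%:R ^+ k * d)
    + ((n k)%:R - j * p%:R ^+ k) * ((n k)%:R - j * p%:R ^+ k - 1) / 2 * v) ->
  (fun k => f (n k) / (n k)%:R ^+ 2) @ \oo -->
    (a - j * d + j ^+ 2 * v / 2) * x ^+ 2 + (d - j * v) * x + v / 2.
Proof.
move=> p_gt1 /andP[x_gt0 x_le1] n Ef.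
have N_ge1 k : 1 <= p%:R ^+ k :> R by rewrite exprn_ege1 // ler1n ltnW.
have N_gt0 k : 0 < p%:R ^+ k :> R by apply: lt_le_trans (N_ge1 k).
have N_le k : p%:R ^+ k <= p%:R ^+ k / x.
  by rewrite ler_pdivlMr // ler_piMr // ltW.
have /all_and2[n_le n_gt] k : (n k)%:R <= p%:R ^+ k / x /\
                              p%:R ^+ k / x < (n k)%:R + 1.
  have /andP[] := @truncn_itv R (p%:R ^+ k / x) (le_trans (ltW (N_gt0 k)) (N_le k)).
  by rewrite natr1.
have n_ge k : p%:R ^+ k <= (n k)%:R :> R.
  by rewrite -natrX ler_nat truncn_ge_nat ?natrX // (le_trans (ltW (N_gt0 k))).
have n_gt0 k : 0 < (n k)%:R :> R by apply: lt_le_trans (n_ge k).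
pose z k : R := (n k)%:R^-1; pose w k := p%:R ^+ k * z k.
have z_cvg : z @ \oo --> (0 : R).
  have geo : (fun k => (p%:R^-1) ^+ k) @ \oo --> (0 : R).
    apply: cvg_expr; rewrite ger0_norm ?invr_ge0 ?ler0n //.
    by rewrite invf_lt1 ?ltr1n // ltr0n ltnW.
  apply: (squeeze_cvgr _ (cvg_cst 0) geo); apply: nearW => k /=.
  by rewrite invr_ge0 ltW //= exprVn lef_pV2 ?posrE.
(* Multiplied by [x / n], the bounds [n <= p^k / x < n + 1] become [x <= w < x + x * z]. *)
have w_cvg : w @ \oo --> x.
  have up : (fun k => x + x * z k) @ \oo --> x.
    suff : (fun k => x + x * z k) @ \oo --> x + x * 0 by rewrite mulr0 addr0.
    exact: cvgD (cvg_cst x) (cvgM (cvg_cst x) z_cvg).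
  apply: (squeeze_cvgr _ (cvg_cst x) up); apply: nearW => k /=.
  apply/andP; split.
    by rewrite /w /z ler_pdivlMr // mulrC -ler_pdivlMr.
  have -> : x + x * z k = ((n k)%:R + 1) * x / (n k)%:R.
    by rewrite /z; field; rewrite gt_eqF.
  by rewrite /w /z ler_pM2r ?invr_gt0 // -ler_pdivrMr // ltW.
have cst (y : R) : (fun _ : nat => y) @ \oo --> y by exact: cvg_cst.
have jw_cvg : (fun k => 1 - j * w k) @ \oo --> 1 - j * x.
  exact: cvgB (cst 1) (cvgM (cst j) w_cvg).
have : (fun k => a * (w k * w k) + b * (w k * z k) + c * (z k * z k) +
      (1 - j * w k) * (w k * d) +
      (1 - j * w k) * (1 - j * w k - z k) * (v / 2)) @ \oo -->
    a * (x * x) + b * (x * 0) + c * (0 * 0) + (1 - j * x) * (x * d) +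
      (1 - j * x) * (1 - j * x - 0) * (v / 2).
  exact: cvgD (cvgD (cvgD (cvgD (cvgM (cst a) (cvgM w_cvg w_cvg))
    (cvgM (cst b) (cvgM w_cvg z_cvg))) (cvgM (cst c) (cvgM z_cvg z_cvg)))
    (cvgM jw_cvg (cvgM w_cvg (cst d))))
    (cvgM (cvgM jw_cvg (cvgB jw_cvg z_cvg)) (cst (v / 2))).
set g := (X in X @ \oo --> _ -> _); set l := (X in g @ \oo --> X -> _).
have -> : g = (fun k => f (n k) / (n k)%:R ^+ 2).
  apply/funext => k; rewrite Ef /g /= /w /z; field.
  by rewrite gt_eqF.
by have -> : l = (a - j * d + j ^+ 2 * v / 2) * x ^+ 2 + (d - j * v) * x + v / 2
  by rewrite /l; field.
Qed.

(** The bounds on [x^-1] place [n k] between [p ^ k * j] and [p ^ k * T], the range where [d] is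
    assumed affine. *)
Lemma cvg_blocks_piece (R : realType) (p j T : nat) (x a b c d v : R) :
  prime p -> 0 < x <= 1 -> j%:R <= x^-1 <= T%:R ->
  (forall k, blocks R p (p ^ k * j) =
     a * (p%:R ^+ k) ^+ 2 + b * p%:R ^+ k + c) ->
  (forall k t, (p ^ k * j + t < p ^ k * T)%N ->
     dblocks R p (p ^ k * j + t) = p%:R ^+ k * d + t%:R * v) ->
  let n := fun k : nat => Num.truncn (p%:R ^+ k / x) in
  (fun k => (num_accessible p (1 + 'X) (n k))%:R / (n k)%:R ^+ 2) @ \oo -->
    (a - j%:R * d + j%:R ^+ 2 * v / 2) * x ^+ 2 + (d - j%:R * v) * x + v / 2.
Proof.
move=> p_pr x01 /andP[jx xT] Ea lin n; have x_gt0 : 0 < x by case/andP: x01.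
have pk_ge0 k : 0 <= p%:R ^+ k :> R by rewrite exprn_ge0.
have px_ge0 k : 0 <= p%:R ^+ k / x by rewrite divr_ge0 // ltW.
have n_ge k : (p ^ k * j <= n k)%N.
  by rewrite truncn_ge_nat // natrM natrX ler_wpM2l.
have n_le k : (n k <= p ^ k * T)%N.
  rewrite -(ler_nat R); apply: le_trans (_ : p%:R ^+ k / x <= _).
    by have /andP[] := truncn_itv (px_ge0 k).
  by rewrite natrM natrX ler_wpM2l.
have -> : (fun k => (num_accessible p (1 + 'X) (n k))%:R / (n k)%:R ^+ 2 : R) =
          (fun k => blocks R p (n k) / (n k)%:R ^+ 2).
  by apply/funext => k; rewrite num_accessible_windows.
apply: cvg_quadratic; rewrite ?prime_gt1 // => k.
apply: (blocks_piece _ _ _ _ _ _ _ _ (n_ge k) (Ea k)) => t ltt.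
by apply: lin; apply: leq_trans ltt (n_le k).
Qed.

Theorem theorem2p13 (R : realType) (p : nat) (x : R) :
  prime p -> (3 <= p)%N -> p%:R^-1 <= x <= 1 ->
  let a := num_accessible p (1 + 'X) in
  let n := fun k : nat => Num.truncn (p%:R ^+ k / x) in
  let u := fun k : nat => (a (n k))%:R / (n k)%:R ^+ 2 : R in
  [/\ p%:R^-1 <= x <= 3^-1 -> u @ \oo --> limit_low p x,
      3^-1 <= x <= 2^-1 -> u @ \oo --> limit_mid p x
    & 2^-1 <= x <= 1 -> u @ \oo --> limit_high p x].
Proof.
move=> p_pr p_gt2 /andP[px x_le1] a n u.
have pr_ge3 : 3 <= p%:R :> R by rewrite ler_nat.
have pr_gt0 : 0 < p%:R :> R by rewrite ltr0n prime_gt0.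
have x_gt0 : 0 < x by apply: lt_le_trans px; rewrite invr_gt0.
have x01 : 0 < x <= 1 by rewrite x_gt0.
have natN k : p%:R ^+ k = (p ^ k)%:R :> R by rewrite natrX.
have d3 : dblocks R p 3 = (p%:R - 1) * (p%:R + 3 * (p%:R - 1)).
  by rewrite dblocks_small.
have linear1 j k t : (0 < j)%N -> (p ^ k * j + t < p ^ k * j.+1)%N ->
    dblocks R p (p ^ k * j + t) = p%:R ^+ k * dblocks R p j +
      t%:R * (dblocks R p j.+1 - dblocks R p j).
  rewrite mulnS => j_gt0 ltt; rewrite dblocks_pow //; [ring | lia].
(* On lengths from [3] to [p] the slope of [d] is [(p - 1) ^ 2] throughout, so the interpolations
   between consecutive multiples of [p ^ k] lie on one line. *)
have linear3 k t : (p ^ k * 3 + t < p ^ k * p)%N ->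
    dblocks R p (p ^ k * 3 + t) = p%:R ^+ k * dblocks R p 3 +
      t%:R * (p%:R - 1) ^+ 2.
  move=> ltt; have pk_gt0 : (0 < p ^ k)%N by rewrite expn_gt0 prime_gt0.
  have lt_mod : (t %% p ^ k < p ^ k)%N by rewrite ltn_mod.
  have Et := divn_eq t (p ^ k).
  have -> : (p ^ k * 3 + t = p ^ k * (3 + t %/ p ^ k) + t %% p ^ k)%N.
    by rewrite {1}Et mulnDr addnA [(p ^ k * (t %/ _))%N]mulnC.
  have q_lt : (3 + t %/ p ^ k < p)%N.
    by rewrite -(ltn_pmul2l pk_gt0); nia.
  rewrite dblocks_pow ?(ltnW lt_mod) // !dblocks_small ?q_lt //; last exact: ltnW.
  have -> : t%:R = (t %/ p ^ k)%:R * p%:R ^+ k + (t %% p ^ k)%:R :> R.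
    by rewrite {1}Et natrD natrM natrX.
  rewrite -[(_ + _).+1%:R]natr1 natrD.
  by move: (p%:R ^+ k) => N; ring.
have [d1 d2] := (dblocks1 R p p_pr, dblocks2 R p p_pr p_gt2).
(* [E1], [E2], [E3] give [a] at the left end of each piece; [E2] and [E3] follow from the one before
   by crossing one interval. *)
have E1 k : blocks R p (p ^ k * 1) = lead_coef_pow R p * (p%:R ^+ k) ^+ 2 +
    (- (p%:R * (p%:R - 1) / 2)) * p%:R ^+ k + defect R p / (p%:R ^+ 2 - 1).
  by rewrite muln1 blocks_pow // mulNr.
pose v1 : R := dblocks R p 2 - dblocks R p 1.
pose v2 : R := dblocks R p 3 - dblocks R p 2.
have E2 k : blocks R p (p ^ k * 2) =
    (lead_coef_pow R p + dblocks R p 1 + v1 / 2) * (p%:R ^+ k) ^+ 2 +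
    (- (p%:R * (p%:R - 1) / 2) - v1 / 2) * p%:R ^+ k +
    defect R p / (p%:R ^+ 2 - 1).
  rewrite (blocks_piece R p k 1 (p ^ k * 2) _ (dblocks R p 1) v1 _ (E1 k)).
  - rewrite natrM -natN; set D := _ / (_ - 1); move: D => D.
    by move: (p%:R ^+ k) => N; field.
  - by rewrite leq_mul2l orbT.
  - by move=> t ltt; exact: linear1.
have E3 k : blocks R p (p ^ k * 3) =
    (lead_coef_pow R p + dblocks R p 1 + v1 / 2 + dblocks R p 2 + v2 / 2)
      * (p%:R ^+ k) ^+ 2 +
    (- (p%:R * (p%:R - 1) / 2) - v1 / 2 - v2 / 2) * p%:R ^+ k +
    defect R p / (p%:R ^+ 2 - 1).
  rewrite (blocks_piece R p k 2 (p ^ k * 3) _ (dblocks R p 2) v2 _ (E2 k)).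
  - rewrite natrM -natN; set D := _ / (_ - 1); move: D => D.
    by move: (p%:R ^+ k) => N; field.
  - by rewrite leq_mul2l orbT.
  - by move=> t ltt; exact: linear1.
have p1 : p%:R + 1 != 0 :> R by rewrite gt_eqF //; lra.
have p21 : p%:R ^+ 2 - 1 != 0 :> R by rewrite gt_eqF //; nra.
have p0 : p%:R != 0 :> R by rewrite gt_eqF.
have inv_le (y z : R) : 0 < y -> y^-1 <= z -> z^-1 <= y.
  by move=> y0 yz; rewrite invf_ple // posrE //; apply: lt_le_trans yz; rewrite invr_gt0.
have inv_ge (y z : R) : 0 < y -> 0 < z -> z <= y^-1 -> y <= z^-1.
  by move=> y0 z0 yz; rewrite -(invrK y) lef_pV2 // posrE invr_gt0.
split=> /andP[xl xr].
- have bnd : 3%:R <= x^-1 <= p%:R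
    by apply/andP; split; [apply: inv_ge | apply: inv_le].
  have := cvg_blocks_piece R p 3 p x _ _ _ _ _ p_pr x01 bnd E3 linear3.
  set l := (X in _ --> X -> _); suff -> : l = limit_low p x by [].
  rewrite /l /v1 /v2 d3 d2 d1 /lead_coef_pow /defect /limit_low.
  (* Completing the square divides by [p - 5], so [p = 5] is checked against the linear
     polynomial. *)
  case: eqP => [->|/eqP p5]; first by field.
  have p5' : p%:R - 5 != 0 :> R by rewrite subr_eq0 eqr_nat.
  by field; rewrite p5' p0 p1 p21.
- have bnd : 2%:R <= x^-1 <= 3%:R
    by apply/andP; split; [apply: inv_ge | apply: inv_le].
  have := cvg_blocks_piece R p 2 3 x _ _ _ _ _ p_pr x01 bnd E2
    (fun k t => linear1 2%N k t isT).
  set l := (X in _ --> X -> _); suff -> : l = limit_mid p x by [].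
  rewrite /l /v1 d3 d2 d1 /lead_coef_pow /defect /limit_mid.
  have den : 7 * p%:R ^+ 3 - 8 * p%:R ^+ 2 - 9 * p%:R + 18 != 0 :> R.
    by rewrite gt_eqF //; nra.
  by field; rewrite den p1 p21.
- have bnd : 1%:R <= x^-1 <= 2%:R
    by apply/andP; split; [rewrite invf_ge1 | apply: inv_le].
  have := cvg_blocks_piece R p 1 2 x _ _ _ _ _ p_pr x01 bnd E1
    (fun k t => linear1 1%N k t isT).
  set l := (X in _ --> X -> _); suff -> : l = limit_high p x by [].
  rewrite /l d2 d1 /lead_coef_pow /defect /limit_high.
  have den : p%:R ^+ 2 + 2 * p%:R + 5 != 0 :> R by rewrite gt_eqF //; nra.
  by field; rewrite den p1 p21.
Qed.
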